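(* Let $0<r<1$ and $y=\frac{\sqrt3}{6}$. For two agents with communication range $r$ starting at the centroid $O$ of the unit-sided equilateral triangle with vertices $A,B,C$, the worst-case evacuation time of the No-Detour algorithm is $$E_{\text{No-Detour}}(2,r)=y+0.5+r+\frac{2(1-r^2)}{2r+1}.$$
   Context: Setting. $T$ is an equilateral triangle with vertices $A,B,C$ and sides of length $1$, $O$ is its centroid, $M$ is the midpoint of $BC$, its height is $h=\frac{\sqrt3}{2}$ and $y=h/3=\frac{\sqrt3}{6}$. A single exit lies at a point of the perimeter of $T$ unknown to the agents. Two agents $R_1,R_2$ start at $O$ at time $0$ and move at speed $1$. An agent recognizes the exit only when it is at the exit's location. The two agents can instantly exchange information exactly when their distance is at most $r$. The evacuation time for a given exit is the first time by which both agents have reached the exit. Generic two-agent algorithm. Each agent moves at unit speed along its predetermined trajectory until it finds the exit or receives a message with the exit's location. If an agent finds the exit at a point $P$ at time $t_P$: if the other agent is within distance $r$, it sends $P$ at once; otherwise it moves in a straight line to the closest point $U$ at which the other agent (still following its own trajectory) can be $r$-intercepted, i.e. so as to come within distance $r$ of the other agent as early as possible (the other agent is then at the first point $Q$ of its trajectory, reached at time $\tau\ge t_P$, with $|PQ|-r\le \tau-t_P$), and sends $P$. After that both agents go straight to $P$. No-Detour algorithm: the generic algorithm in which $R_1$ follows the polygonal trajectory $\langle O,M,B,A\rangle$ and $R_2$ follows $\langle O,M,C,A\rangle$. $E_{\text{No-Detour}}(2,r)$ is the supremum, over all exit locations on the perimeter of $T$, of the evacuation time of this algorithm. *)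

(* Defs.v *)
(* Stdlib reals with Coquelicot's extended reals. *)
From Stdlib Require Import Reals List.
From Coquelicot Require Import Coquelicot.
Import ListNotations.
Open Scope R_scope.

Definition point : Type := (R * R)%type.

Definition pdist (P Q : point) : R := dist_euc (fst P) (snd P) (fst Q) (snd Q).

(* The point P + s (Q - P) of the line PQ. *)
Definition lerp (P Q : point) (s : R) : point :=
  (fst P + s * (fst Q - fst P), snd P + s * (snd Q - snd P)).

Definition on_segment (P Q X : point) : Prop :=
  exists s : R, 0 <= s <= 1 /\ X = lerp P Q s.

Definition on_perimeter (A B C X : point) : Prop :=
  on_segment A B X \/ on_segment B C X \/ on_segment C A X.

Definition midpoint (P Q : point) : point := lerp P Q (1 / 2).

Definition centroid (A B C : point) : point :=
  ((fst A + fst B + fst C) / 3, (snd A + snd B + snd C) / 3).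

(* Position at time t >= 0 of an agent that starts at P at time 0, follows the
   polygonal line through the points of l at unit speed, and then stays at the
   last one. Edges of length 0 are harmless: [lerp P P _] is P. *)
Fixpoint walk (P : point) (l : list point) (t : R) : point :=
  match l with
  | [] => P
  | Q :: l' =>
      if Rle_dec t (pdist P Q) then lerp P Q (t / pdist P Q)
      else walk Q l' (t - pdist P Q)
  end.

(* All the "first times" below are infima of closed sets of times, hence are
   attained when they are finite; they are +oo when the event never occurs. *)

Definition discovery_time (X : R -> point) (P : point) : Rbar :=
  Glb_Rbar (fun t => 0 <= t /\ X t = P).

(* First time at which an agent that leaves P at time tP can be within
   distance r of the agent moving along Y; it is tP itself when the agents are
   already within distance r of each other at time tP. *)
Definition interception_time (Y : R -> point) (r : R) (P : point) (tP : R)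
  : Rbar :=
  Glb_Rbar (fun t => tP <= t /\ pdist P (Y t) - r <= t - tP).

(* The point closest to P at distance at most r from Q. *)
Definition interception_point (r : R) (P Q : point) : point :=
  lerp P Q (Rmax 0 (pdist P Q - r) / pdist P Q).

Definition visited_by (X : R -> point) (P : point) (t : R) : Prop :=
  exists s : R, 0 <= s <= t /\ X s = P.

(* Evacuation time when the agent with trajectory X finds the exit P at time
   tP, before the agent with trajectory Y does: F and G are the motions that
   the finder and the other agent actually perform. *)
Definition evacuation_time_from (X Y : R -> point) (r : R) (P : point) (tP : R)
  : Rbar :=
  match interception_time Y r P tP with
  | Finite tau =>
      let Q := Y tau in
      let U := interception_point r P Q in
      let F := fun t => if Rle_dec t tP then X t else walk P [U; P] (t - tP) in
      let G := fun t => if Rle_dec t tau then Y t else walk Q [P] (t - tau) in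
      Glb_Rbar (fun t => visited_by F P t /\ visited_by G P t)
  | _ => p_infty
  end.

(* Evacuation time of the generic algorithm with trajectories X1, X2. If both
   agents find the exit at the same time then it does not matter which of them
   is regarded as the finder, as they are at the same point. *)
Definition evacuation_time (X1 X2 : R -> point) (r : R) (P : point) : Rbar :=
  let t1 := discovery_time X1 P in
  let t2 := discovery_time X2 P in
  if Rbar_le_dec t1 t2 then
    match t1 with
    | Finite tP => evacuation_time_from X1 X2 r P tP
    | _ => p_infty
    end
  else
    match t2 with
    | Finite tP => evacuation_time_from X2 X1 r P tP
    | _ => p_infty
    end.

Definition no_detour_1 (A B C : point) : R -> point :=
  walk (centroid A B C) [midpoint B C; B; A].

Definition no_detour_2 (A B C : point) : R -> point :=
  walk (centroid A B C) [midpoint B C; C; A].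

Definition E_no_detour (A B C : point) (r : R) : Rbar :=
  Rbar_lub (fun T => exists P : point, on_perimeter A B C P /\
    T = evacuation_time (no_detour_1 A B C) (no_detour_2 A B C) r P).

(* Main.v *)
(** An exit found at [P] at time [tP] is evacuated at time [tau + |PQ|], where [Q] is
    the position of the other agent at the interception time [tau]. Trajectories are
    1-Lipschitz, so [t + |P Y(t)|] is nondecreasing in [t]: any time [t] satisfying the
    interception condition gives the upper bound [t + |P Y(t)|]. For an exit on the base
    at distance [u] from [M] with [2u > r], the other agent is intercepted at distance
    [(2u-r)(1+r)/(3/2-u+2r)] from its base vertex; for an exit at distance [a > r] from
    [A], after a chase of duration [(a^2-r^2)/(a+2r)]. The resulting bounds are monotone
    in [u] and [a] and their common maximum is reached at the base vertices, where the
    interception time is exact. *)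
Require Import Defs.
From Stdlib Require Import Reals List Psatz.
From Coquelicot Require Import Coquelicot.
Import ListNotations.
Open Scope R_scope.

(** * Euclidean distance and unit-speed polygonal walks *)

Lemma pdist_sq (P Q : point) :
  pdist P Q ^ 2 = (fst P - fst Q) ^ 2 + (snd P - snd Q) ^ 2.
Proof.
  unfold pdist, dist_euc.
  rewrite pow2_sqrt; [unfold Rsqr; ring|].
  apply Rplus_le_le_0_compat; apply Rle_0_sqr.
Qed.

Lemma pdist_ge0 (P Q : point) : 0 <= pdist P Q.
Proof. apply sqrt_pos. Qed.

Lemma pdist_eq (P Q : point) (d : R) : 0 <= d -> pdist P Q ^ 2 = d ^ 2 -> pdist P Q = d.
Proof.
  intros Hd H. apply Rsqr_inj; [apply pdist_ge0|exact Hd|].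
  rewrite !Rsqr_pow2. exact H.
Qed.

Lemma pdist_refl (P : point) : pdist P P = 0.
Proof. apply pdist_eq; [lra|]. rewrite pdist_sq. ring. Qed.

Lemma pdist_sym (P Q : point) : pdist P Q = pdist Q P.
Proof. apply pdist_eq; [apply pdist_ge0|]. rewrite !pdist_sq. ring. Qed.

Lemma pdist_triangle (P Q S : point) : pdist P S <= pdist P Q + pdist Q S.
Proof. apply triangle. Qed.

Lemma pdist_eq0 (P Q : point) : pdist P Q = 0 -> P = Q.
Proof.
  intros H. assert (H2 := pdist_sq P Q). rewrite H in H2.
  rewrite pow_ne_zero in H2 by discriminate.
  assert (H3 := pow2_ge_0 (fst P - fst Q)). assert (H4 := pow2_ge_0 (snd P - snd Q)).
  apply injective_projections; apply Rminus_diag_uniq; apply Rsqr_0_uniq;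
    rewrite Rsqr_pow2; lra.
Qed.

Lemma lerp_0 (P Q : point) : lerp P Q 0 = P.
Proof. destruct P, Q; unfold lerp; simpl; f_equal; ring. Qed.

Lemma lerp_1 (P Q : point) : lerp P Q 1 = Q.
Proof. destruct P, Q; unfold lerp; simpl; f_equal; ring. Qed.

Lemma pdist_lerp (P Q : point) (s t : R) :
  s <= t -> pdist (lerp P Q s) (lerp P Q t) = (t - s) * pdist P Q.
Proof.
  intros Hst. apply pdist_eq.
  - apply Rmult_le_pos; [lra|apply pdist_ge0].
  - rewrite Rpow_mult_distr, !pdist_sq. unfold lerp; simpl. ring.
Qed.

Lemma walk_0 (P : point) (l : list point) : walk P l 0 = P.
Proof.
  destruct l as [|Q l]; simpl; [reflexivity|].
  destruct (Rle_dec 0 (pdist P Q)) as [_|H].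
  - unfold Rdiv. rewrite Rmult_0_l. apply lerp_0.
  - destruct H. apply pdist_ge0.
Qed.

Lemma walk_le (P Q : point) (l : list point) (t : R) :
  t <= pdist P Q -> walk P (Q :: l) t = lerp P Q (t / pdist P Q).
Proof. intros H. simpl. destruct (Rle_dec t (pdist P Q)); [reflexivity|lra]. Qed.

(** At [t = pdist P Q] both branches of [walk] give [Q], even on an edge of length 0, so each leg
    can be treated as a closed time interval. *)
Lemma walk_ge (P Q : point) (l : list point) (t : R) :
  pdist P Q <= t -> walk P (Q :: l) t = walk Q l (t - pdist P Q).
Proof.
  intros H. simpl. destruct (Rle_dec t (pdist P Q)) as [H'|]; [|reflexivity].
  replace t with (pdist P Q) by lra.
  rewrite Rminus_diag, walk_0.
  destruct (Req_dec (pdist P Q) 0) as [E|E].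
  - rewrite E. unfold Rdiv. rewrite Rmult_0_l, lerp_0. apply pdist_eq0, E.
  - rewrite Rdiv_diag by exact E. apply lerp_1.
Qed.

(** Within the first edge this is [pdist_lerp]; after it, the induction hypothesis. If [s] and [t]
    lie on different sides of the vertex [Q], the triangle inequality through [Q] joins the two
    estimates. *)
Lemma walk_lipschitz (l : list point) (P : point) (s t : R) :
  0 <= s <= t -> pdist (walk P l s) (walk P l t) <= t - s.
Proof.
  revert P s t. induction l as [|Q l IH]; intros P s t Hst.
  - simpl. rewrite pdist_refl. lra.
  - assert (leg : forall s t, 0 <= s <= t -> t <= pdist P Q ->
      pdist (walk P (Q :: l) s) (walk P (Q :: l) t) <= t - s).
    { clear s t Hst. intros s t Hst Ht.
      rewrite !walk_le by lra.
      destruct (Req_dec (pdist P Q) 0) as [E|E].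
      - replace s with 0 by lra. replace t with 0 by lra.
        rewrite pdist_refl. lra.
      - assert (H0 := pdist_ge0 P Q).
        rewrite pdist_lerp.
        + apply Req_le. field. exact E.
        + apply Rmult_le_compat_r; [|lra].
          left. apply Rinv_0_lt_compat. lra. }
    destruct (Rle_dec t (pdist P Q)) as [Ht|Ht]; [apply leg; lra|].
    destruct (Rle_dec s (pdist P Q)) as [Hs|Hs].
    + assert (H1 := leg s (pdist P Q) ltac:(lra) ltac:(lra)).
      rewrite (walk_ge P Q l (pdist P Q)), Rminus_diag, walk_0 in H1 by lra.
      assert (H2 := IH Q 0 (t - pdist P Q) ltac:(lra)). rewrite walk_0 in H2.
      rewrite (walk_ge P Q l t) by lra.
      assert (H3 := pdist_triangle (walk P (Q :: l) s) Q (walk Q l (t - pdist P Q))).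
      lra.
    + rewrite !walk_ge by lra.
      assert (H1 := IH Q (s - pdist P Q) (t - pdist P Q) ltac:(lra)). lra.
Qed.

(** * Infima of sets of times and bounds for the generic algorithm *)

Lemma Glb_Rbar_min (E : R -> Prop) (m : R) :
  E m -> (forall t, E t -> m <= t) -> Glb_Rbar E = Finite m.
Proof.
  intros Hm Hlow. apply is_glb_Rbar_unique. split.
  - intros t Ht. apply Hlow, Ht.
  - intros b Hb. exact (Hb m Hm).
Qed.

Lemma Glb_Rbar_le (E : R -> Prop) (t : R) : E t -> Rbar_le (Glb_Rbar E) t.
Proof. intros Ht. exact (proj1 (Glb_Rbar_correct E) t Ht). Qed.

Lemma Glb_Rbar_empty (E : R -> Prop) : (forall t, ~ E t) -> Glb_Rbar E = p_infty.
Proof.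
  intros H. apply is_glb_Rbar_unique. split.
  - intros t Ht. destruct (H t Ht).
  - intros b _. destruct b; exact I.
Qed.

(** The interception time [tau] is finite, as it lies between [tP] and [t]. From [Q] the other agent
    needs [pdist Q P] more, and the Lipschitz property replaces [tau] by the witness [t]. *)
Lemma evacuation_time_from_le (X : R -> point) (O P : point) (l : list point)
    (r tP t : R) :
  0 <= tP -> X tP = P -> tP <= t -> pdist P (walk O l t) - r <= t - tP ->
  Rbar_le (evacuation_time_from X (walk O l) r P tP) (t + pdist P (walk O l t)).
Proof.
  intros HtP HX Ht Hev. unfold evacuation_time_from.
  assert (Hle : Rbar_le (interception_time (walk O l) r P tP) t).
  { apply Glb_Rbar_le. split; assumption. }
  assert (Hge : Rbar_le tP (interception_time (walk O l) r P tP)).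
  { apply (proj2 (Glb_Rbar_correct _)). intros x [Hx _]. exact Hx. }
  destruct (interception_time (walk O l) r P tP) as [tau| |];
    [|destruct Hle|destruct Hge].
  simpl in Hle, Hge. cbv zeta.
  set (Q := walk O l tau).
  assert (HQ := pdist_ge0 Q P).
  apply Rbar_le_trans with (Finite (tau + pdist Q P)).
  - apply Glb_Rbar_le. split.
    + exists tP. split; [lra|].
      destruct (Rle_dec tP tP); [exact HX|lra].
    + exists (tau + pdist Q P). split; [lra|].
      (* The first case means [pdist Q P = 0]: the other agent is already at [P] when
         intercepted. *)
      destruct (Rle_dec (tau + pdist Q P) tau).
      * replace (tau + pdist Q P) with tau by lra.
        apply pdist_eq0. fold Q. lra.
      * rewrite walk_ge by lra. reflexivity.
  - simpl.
    assert (H1 := walk_lipschitz l O tau t ltac:(lra)).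
    assert (H2 := pdist_triangle Q (walk O l t) P).
    fold Q in H1. rewrite (pdist_sym P). lra.
Qed.

(** As [Y] never visits [P], the other agent can reach [P] only on its final straight leg, which
    takes at least [pdist Q P] at unit speed. *)
Lemma evacuation_time_from_eq (X Y : R -> point) (P : point) (r tP tau : R) :
  0 <= tP -> X tP = P -> (forall t, 0 <= t -> Y t <> P) ->
  tP <= tau -> pdist P (Y tau) - r <= tau - tP ->
  (forall t, tP <= t -> pdist P (Y t) - r <= t - tP -> tau <= t) ->
  evacuation_time_from X Y r P tP = Finite (tau + pdist P (Y tau)).
Proof.
  intros HtP HX HY Htau Hev Hmin. unfold evacuation_time_from.
  replace (interception_time Y r P tP) with (Finite tau).
  2:{ symmetry. apply Glb_Rbar_min; [split; assumption|].
      intros t [H1 H2]. apply Hmin; assumption. }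
  cbv zeta. set (Q := Y tau). rewrite (pdist_sym P Q).
  assert (HQ := pdist_ge0 Q P).
  apply Glb_Rbar_min.
  - split.
    + exists tP. split; [lra|]. destruct (Rle_dec tP tP); [exact HX|lra].
    + exists (tau + pdist Q P). split; [lra|].
      destruct (Rle_dec (tau + pdist Q P) tau).
      * replace (tau + pdist Q P) with tau by lra.
        apply pdist_eq0. fold Q. lra.
      * rewrite walk_ge by lra. reflexivity.
  - intros t [_ [s [Hs HG]]]. destruct (Rle_dec s tau) as [Hst|Hst].
    + destruct (HY s); [lra|exact HG].
    + assert (H := walk_lipschitz [P] Q 0 (s - tau) ltac:(lra)).
      rewrite walk_0, HG in H. lra.
Qed.

(** * Barycentric coordinates in an equilateral triangle *)

Definition unit_triangle (A B C : point) : Prop :=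
  pdist A B = 1 /\ pdist B C = 1 /\ pdist C A = 1.

Definition bary (A B C : point) (a b c : R) : point :=
  (a * fst A + b * fst B + c * fst C, a * snd A + b * snd B + c * snd C).

Lemma bary_swap (A B C : point) (a b c : R) : bary A C B a c b = bary A B C a b c.
Proof. unfold bary. f_equal; ring. Qed.

Lemma unit_triangle_swap (A B C : point) : unit_triangle A B C -> unit_triangle A C B.
Proof.
  intros (H1 & H2 & H3).
  split; [|split]; rewrite pdist_sym; assumption.
Qed.

Lemma lerp_bary (A B C : point) (a b c a' b' c' s : R) :
  lerp (bary A B C a b c) (bary A B C a' b' c') s =
  bary A B C (a + s * (a' - a)) (b + s * (b' - b)) (c + s * (c' - c)).
Proof. unfold lerp, bary; simpl. f_equal; ring. Qed.

Lemma pdist_bary (A B C : point) (a b c a' b' c' : R) :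
  unit_triangle A B C -> a + b + c = 1 -> a' + b' + c' = 1 ->
  pdist (bary A B C a b c) (bary A B C a' b' c') ^ 2 =
  (a - a') ^ 2 + (a - a') * (b - b') + (b - b') ^ 2.
Proof.
  intros (H1 & H2 & H3) Hs Hs'.
  replace c with (1 - a - b) by lra. replace c' with (1 - a' - b') by lra.
  assert (E1 := pdist_sq A B). assert (E2 := pdist_sq B C).
  assert (E3 := pdist_sq C A). rewrite H1 in E1. rewrite H2 in E2. rewrite H3 in E3.
  rewrite pdist_sq. unfold bary; simpl fst; simpl snd.
  set (u := a - a'). set (v := b - b').
  (* The displacement is u(A-C) + v(B-C), and twice the inner product of A-C and B-C is |CA|^2 +
     |BC|^2 - |AB|^2. The three factors [1 ^ 2] stand for |CA|^2, |BC|^2 and |AB|^2, in this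
     order. *)
  transitivity ((u ^ 2 + u * v) * (1 ^ 2) + (v ^ 2 + u * v) * 1 ^ 2 - u * v * 1 ^ 2);
    [|ring].
  rewrite E3 at 1. rewrite E2 at 1. rewrite E1. unfold u, v. ring.
Qed.

(** The form u^2 + uv + v^2 is half of u^2 + v^2 + (u+v)^2, hence positive definite. *)
Lemma bary_inj (A B C : point) (a b c a' b' c' : R) :
  unit_triangle A B C -> a + b + c = 1 -> a' + b' + c' = 1 ->
  bary A B C a b c = bary A B C a' b' c' -> a = a' /\ b = b' /\ c = c'.
Proof.
  intros HT Hs Hs' E.
  assert (H := pdist_bary A B C a b c a' b' c' HT Hs Hs').
  rewrite E, pdist_refl in H.
  rewrite pow_ne_zero in H by discriminate.
  set (u := a - a') in *. set (v := b - b') in *.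
  assert (H1 := pow2_ge_0 u). assert (H2 := pow2_ge_0 v).
  assert (H3 := pow2_ge_0 (u + v)).
  assert (u = 0) by (apply Rsqr_0_uniq; rewrite Rsqr_pow2; lra).
  assert (v = 0) by (apply Rsqr_0_uniq; rewrite Rsqr_pow2; lra).
  unfold u, v in *. lra.
Qed.

(** * Explicit positions along the two trajectories *)

(** The y of the theorem: the distance from the centroid to a side, hence the time at which both
    agents reach the midpoint of the base. *)
Definition apothem : R := sqrt 3 / 6.

Lemma apothem_gt0 : 0 < apothem.
Proof. unfold apothem. assert (0 < sqrt 3) by (apply sqrt_lt_R0; lra). lra. Qed.

(** Exchanging B and C exchanges the agents, so positions need to be computed for [no_detour_2]
    only. *)
Lemma no_detour_1_swap (A B C : point) : no_detour_1 A B C = no_detour_2 A C B.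
Proof.
  unfold no_detour_1, no_detour_2.
  replace (midpoint C B) with (midpoint B C)
    by (unfold midpoint, lerp; f_equal; field).
  replace (centroid A C B) with (centroid A B C)
    by (unfold centroid; f_equal; field).
  reflexivity.
Qed.

Lemma centroid_bary (A B C : point) : centroid A B C = bary A B C (1/3) (1/3) (1/3).
Proof. unfold centroid, bary; f_equal; field. Qed.

Lemma midpoint_bary (A B C : point) : midpoint B C = bary A B C 0 (1/2) (1/2).
Proof. unfold midpoint, lerp, bary; f_equal; field. Qed.

Lemma vertex_bary (A B C : point) :
  A = bary A B C 1 0 0 /\ B = bary A B C 0 1 0 /\ C = bary A B C 0 0 1.
Proof.
  destruct A, B, C; unfold bary; simpl.
  split; [|split]; f_equal; ring.
Qed.

Lemma pdist_centroid_midpoint (A B C : point) :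
  unit_triangle A B C -> pdist (centroid A B C) (midpoint B C) = apothem.
Proof.
  intros HT. apply pdist_eq; [assert (H := apothem_gt0); lra|].
  rewrite centroid_bary, (midpoint_bary A B C), pdist_bary by (assumption || lra).
  unfold apothem.
  replace ((sqrt 3 / 6) ^ 2) with (sqrt 3 ^ 2 / 36) by field.
  rewrite pow2_sqrt by lra. field.
Qed.

Lemma pdist_midpoint_vertex (A B C : point) :
  unit_triangle A B C -> pdist (midpoint B C) C = 1 / 2.
Proof.
  intros HT. apply pdist_eq; [lra|].
  rewrite (midpoint_bary A B C).
  rewrite (proj2 (proj2 (vertex_bary A B C))) at 2.
  rewrite pdist_bary by (assumption || lra). field.
Qed.

Lemma no_detour_2_approach (A B C : point) (s : R) :
  unit_triangle A B C -> s <= 1 ->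
  no_detour_2 A B C (s * apothem) =
  bary A B C ((1 - s) / 3) ((2 + s) / 6) ((2 + s) / 6).
Proof.
  intros HT Hs. assert (Hy := apothem_gt0). unfold no_detour_2.
  rewrite walk_le; rewrite pdist_centroid_midpoint by assumption; [|nra].
  replace (s * apothem / apothem) with s by (field; lra).
  rewrite centroid_bary, (midpoint_bary A B C), lerp_bary.
  f_equal; field.
Qed.

Lemma no_detour_2_base (A B C : point) (u : R) :
  unit_triangle A B C -> 0 <= u <= 1 / 2 ->
  no_detour_2 A B C (apothem + u) = bary A B C 0 (1 / 2 - u) (1 / 2 + u).
Proof.
  intros HT Hu. unfold no_detour_2.
  rewrite walk_ge; rewrite pdist_centroid_midpoint by assumption; [|lra].
  rewrite walk_le; rewrite (pdist_midpoint_vertex A) by assumption; [|lra].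
  rewrite (midpoint_bary A B C).
  rewrite (proj2 (proj2 (vertex_bary A B C))) at 2.
  rewrite lerp_bary. f_equal; field.
Qed.

Lemma no_detour_2_side (A B C : point) (s : R) :
  unit_triangle A B C -> 0 <= s <= 1 ->
  no_detour_2 A B C (apothem + 1 / 2 + s) = bary A B C s 0 (1 - s).
Proof.
  intros HT Hs. unfold no_detour_2.
  rewrite walk_ge; rewrite pdist_centroid_midpoint by assumption; [|lra].
  rewrite walk_ge; rewrite (pdist_midpoint_vertex A) by assumption; [|lra].
  destruct HT as (H1 & H2 & H3).
  rewrite walk_le; rewrite H3; [|lra].
  unfold lerp, bary. f_equal; field.
Qed.

Lemma no_detour_2_end (A B C : point) (s : R) :
  unit_triangle A B C -> 1 <= s ->
  no_detour_2 A B C (apothem + 1 / 2 + s) = bary A B C 1 0 0.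
Proof.
  intros HT Hs. unfold no_detour_2.
  rewrite walk_ge; rewrite pdist_centroid_midpoint by assumption; [|lra].
  rewrite walk_ge; rewrite (pdist_midpoint_vertex A) by assumption; [|lra].
  destruct HT as (H1 & H2 & H3).
  rewrite walk_ge; rewrite H3; [|lra].
  apply (proj1 (vertex_bary A B C)).
Qed.

(** All cases are linear in the coordinates and times, so comparing two positions becomes linear
    arithmetic. Before time [apothem] the agent is strictly inside the triangle. *)
Lemma no_detour_2_cases (A B C : point) (t : R) :
  unit_triangle A B C -> 0 <= t ->
  exists a b c, no_detour_2 A B C t = bary A B C a b c /\ a + b + c = 1 /\
  ((t < apothem /\ 0 < a /\ 0 < b /\ 0 < c) \/
   (exists u, 0 <= u <= 1 / 2 /\ t = apothem + u /\
      a = 0 /\ b = 1 / 2 - u /\ c = 1 / 2 + u) \/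
   (exists s, 0 <= s <= 1 /\ t = apothem + 1 / 2 + s /\
      a = s /\ b = 0 /\ c = 1 - s) \/
   (apothem + 3 / 2 <= t /\ a = 1 /\ b = 0 /\ c = 0)).
Proof.
  intros HT Ht. assert (Hy := apothem_gt0).
  destruct (Rlt_dec t apothem) as [H1|H1].
  { assert (E : t / apothem * apothem = t) by (field; lra).
    assert (H : 0 <= t / apothem < 1) by nra.
    exists ((1 - t / apothem) / 3), ((2 + t / apothem) / 6), ((2 + t / apothem) / 6).
    split; [|split; [field; lra|left; lra]].
    rewrite <- no_detour_2_approach by (assumption || lra). rewrite E. reflexivity. }
  destruct (Rle_dec t (apothem + 1 / 2)) as [H2|H2].
  { exists 0, (1 / 2 - (t - apothem)), (1 / 2 + (t - apothem)).
    split; [|split; [field|right; left; exists (t - apothem); lra]].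
    rewrite <- no_detour_2_base by (assumption || lra). f_equal; ring. }
  destruct (Rle_dec t (apothem + 3 / 2)) as [H3|H3].
  { exists (t - apothem - 1 / 2), 0, (1 - (t - apothem - 1 / 2)).
    split; [|split; [field|right; right; left; exists (t - apothem - 1 / 2); lra]].
    rewrite <- no_detour_2_side by (assumption || lra). f_equal; ring. }
  exists 1, 0, 0. split; [|split; [ring|right; right; right; lra]].
  rewrite <- (no_detour_2_end A B C (t - apothem - 1 / 2)) by (assumption || lra).
  f_equal; ring.
Qed.

(** * Discovery times and meeting points of the trajectories *)

Lemma no_detour_2_discovery (A B C : point) (u : R) :
  unit_triangle A B C -> 0 <= u <= 3 / 2 ->
  discovery_time (no_detour_2 A B C) (no_detour_2 A B C (apothem + u)) =
  Finite (apothem + u).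
Proof.
  intros HT Hu. assert (Hy := apothem_gt0).
  apply Glb_Rbar_min; [split; [lra|reflexivity]|].
  intros t [Ht E].
  destruct (no_detour_2_cases A B C t HT Ht) as (a & b & c & Et & Hs & Hc).
  destruct (no_detour_2_cases A B C (apothem + u) HT ltac:(lra))
    as (a' & b' & c' & Eu & Hs' & Hc').
  rewrite Et, Eu in E. apply bary_inj in E; [|assumption..].
  destruct Hc as [Hc|[[v Hc]|[[v Hc]|Hc]]];
    destruct Hc' as [Hc'|[[w Hc']|[[w Hc']|Hc']]]; lra.
Qed.

(** On the perimeter the agents sweep opposite halves, which share only the midpoint of the base
    ([u = 0]) and the apex ([u = 3 / 2]). *)
Lemma no_detour_meet (A B C : point) (t u : R) :
  unit_triangle A B C -> 0 <= t -> 0 <= u <= 3 / 2 ->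
  no_detour_2 A B C t = no_detour_1 A B C (apothem + u) ->
  apothem + u <= t /\ (u = 0 \/ u = 3 / 2).
Proof.
  intros HT Ht Hu E. assert (Hy := apothem_gt0). rewrite no_detour_1_swap in E.
  destruct (no_detour_2_cases A B C t HT Ht) as (a & b & c & Et & Hs & Hc).
  destruct (no_detour_2_cases A C B (apothem + u) (unit_triangle_swap _ _ _ HT) ltac:(lra))
    as (a' & c' & b' & Eu & Hs' & Hc').
  rewrite Et, Eu, (bary_swap A B C) in E. apply bary_inj in E; [|assumption|lra|lra].
  destruct Hc as [Hc|[[v Hc]|[[v Hc]|Hc]]];
    destruct Hc' as [Hc'|[[w Hc']|[[w Hc']|Hc']]]; try lra;
    (split; [lra|]); first [left; lra|right; lra].
Qed.

Lemma no_detour_meet_eq (A B C : point) (u : R) :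
  unit_triangle A B C -> u = 0 \/ u = 3 / 2 ->
  no_detour_1 A B C (apothem + u) = no_detour_2 A B C (apothem + u).
Proof.
  intros HT Hu. assert (HT' := unit_triangle_swap _ _ _ HT).
  rewrite no_detour_1_swap.
  destruct Hu as [-> | ->].
  - rewrite !no_detour_2_base by (assumption || lra). rewrite bary_swap.
    f_equal; ring.
  - replace (apothem + 3 / 2) with (apothem + 1 / 2 + 1) by field.
    rewrite !no_detour_2_end by (assumption || lra). apply bary_swap.
Qed.

(** Parametrizes every exit by the time [u] elapsed after the agents reach the midpoint of the
    base. *)
Lemma on_perimeter_no_detour (A B C P : point) :
  unit_triangle A B C -> on_perimeter A B C P ->
  exists u, 0 <= u <= 3 / 2 /\
    (P = no_detour_1 A B C (apothem + u) \/ P = no_detour_2 A B C (apothem + u)).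
Proof.
  intros HT HP. assert (HT' := unit_triangle_swap _ _ _ HT).
  rewrite no_detour_1_swap.
  destruct HP as [[s [Hs ->]]|[[s [Hs ->]]|[s [Hs ->]]]].
  - exists (1 / 2 + (1 - s)). split; [lra|]. left.
    rewrite <- Rplus_assoc, no_detour_2_side by (assumption || lra).
    unfold lerp, bary; f_equal; field.
  - destruct (Rle_dec s (1 / 2)).
    + exists (1 / 2 - s). split; [lra|]. left.
      rewrite no_detour_2_base by (assumption || lra).
      unfold lerp, bary; f_equal; field.
    + exists (s - 1 / 2). split; [lra|]. right.
      rewrite no_detour_2_base by (assumption || lra).
      unfold lerp, bary; f_equal; field.
  - exists (1 / 2 + s). split; [lra|]. right.
    rewrite <- Rplus_assoc, no_detour_2_side by (assumption || lra).
    unfold lerp, bary; f_equal; field.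
Qed.

(** * Upper bound when the first agent is the finder *)

Definition no_detour_worst (r : R) : R :=
  apothem + 1 / 2 + r + 2 * (1 - r ^ 2) / (2 * r + 1).

(** Settles the exits that are announced at the moment of discovery: their evacuation ends by
    [apothem + 3 / 2]. *)
Lemma no_detour_worst_ge (r : R) : 0 < r < 1 -> apothem + 3 / 2 <= no_detour_worst r.
Proof.
  intros Hr. unfold no_detour_worst.
  assert (E : 2 * (1 - r ^ 2) / (2 * r + 1) - (1 - r) = (1 - r) / (2 * r + 1))
    by (field; lra).
  assert (0 < (1 - r) / (2 * r + 1)) by (apply Rdiv_lt_0_compat; lra).
  lra.
Qed.

Lemma base_interception_bound (r u : R) :
  0 < r < 1 -> r <= 2 * u <= 1 ->
  apothem + 1 + r - u + 2 * ((2 * u - r) * (1 + r) / (3 / 2 - u + 2 * r))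
  <= no_detour_worst r.
Proof.
  intros Hr Hu. unfold no_detour_worst.
  apply Rminus_le_0.
  (* The factor [1 / 2 - u] vanishes at the base vertex, where the bound is attained. *)
  replace (_ - _) with ((1 / 2 - u) *
    (6 * (1 + r) ^ 2 - (2 * r + 1) * (3 / 2 - u + 2 * r)) /
    ((2 * r + 1) * (3 / 2 - u + 2 * r))) by (field; lra).
  apply Rdiv_le_0_compat; [apply Rmult_le_pos; nra|nra].
Qed.

Lemma side_interception_bound (r a : R) :
  0 < r < 1 -> r <= a <= 1 ->
  apothem + 3 / 2 - a + r + 2 * ((a ^ 2 - r ^ 2) / (a + 2 * r)) <= no_detour_worst r.
Proof.
  intros Hr Ha. unfold no_detour_worst.
  apply Rminus_le_0.
  (* Again the first factor vanishes at the base vertex, now [a = 1]. *)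
  replace (_ - _) with ((1 - a) * ((1 + 2 * r) * (a + 2 * r) - 6 * r ^ 2) /
    ((2 * r + 1) * (a + 2 * r))) by (field; lra).
  apply Rdiv_le_0_compat; [apply Rmult_le_pos; nra|nra].
Qed.

Lemma evacuation_time_from_no_detour_le (A B C : point) (r u : R) :
  unit_triangle A B C -> 0 < r < 1 -> 0 <= u <= 3 / 2 ->
  Rbar_le (evacuation_time_from (no_detour_1 A B C) (no_detour_2 A B C) r
             (no_detour_1 A B C (apothem + u)) (apothem + u))
          (no_detour_worst r).
Proof.
  intros HT Hr Hu. assert (Hy := apothem_gt0).
  assert (HT' := unit_triangle_swap _ _ _ HT).
  assert (Hw := no_detour_worst_ge r Hr).
  set (P := no_detour_1 A B C (apothem + u)).
  (* It suffices to exhibit a time [t] and the distance [d] from the exit to the other agent at that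
     time. *)
  assert (bound : forall t d, apothem + u <= t ->
    0 <= d -> pdist P (no_detour_2 A B C t) ^ 2 = d ^ 2 ->
    d - r <= t - (apothem + u) -> t + d <= no_detour_worst r ->
    Rbar_le (evacuation_time_from (no_detour_1 A B C) (no_detour_2 A B C) r
      P (apothem + u)) (no_detour_worst r)).
  { intros t d Ht Hd Hsq Hev Hle.
    assert (Ed := pdist_eq _ _ _ Hd Hsq).
    apply Rbar_le_trans with (Finite (t + pdist P (no_detour_2 A B C t)));
      [|rewrite Ed; exact Hle].
    apply evacuation_time_from_le; [lra|reflexivity|exact Ht|].
    fold (no_detour_2 A B C). rewrite Ed. exact Hev. }
  destruct (Rle_dec u (1 / 2)) as [Hb|Hb].
  - assert (EP : P = bary A B C 0 (1 / 2 + u) (1 / 2 - u)).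
    { unfold P. rewrite no_detour_1_swap, no_detour_2_base by (assumption || lra).
      apply bary_swap. }
    destruct (Rle_dec (2 * u) r) as [Hur|Hur].
    + apply (bound (apothem + u) (2 * u)); try lra.
      rewrite EP, no_detour_2_base, pdist_bary by (assumption || lra). field.
    + assert (Hbd := base_interception_bound r u Hr ltac:(lra)).
      (* With e = 1/2 + u the distance from [P] to [C], this solves e^2 - e s + s^2 = (1/2 - u + r +
         s)^2, which is linear in s: the law of cosines at [C] gives the left side, and the right
         side is the square of [r] plus the time since discovery. *)
      set (s := (2 * u - r) * (1 + r) / (3 / 2 - u + 2 * r)) in *.
      assert (Es : s * (3 / 2 - u + 2 * r) = (2 * u - r) * (1 + r))
        by (unfold s; field; lra).
      assert (Hs : 0 <= s <= 1) by nra.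
      apply (bound (apothem + 1 / 2 + s) (1 / 2 - u + r + s)); try lra.
      rewrite EP, no_detour_2_side, pdist_bary by (assumption || lra). nra.
  (* Both agents are now at distance [a] from the apex, hence at distance [a] from each other. *)
  - set (a := 3 / 2 - u).
    assert (EP : P = bary A B C (1 - a) a 0).
    { unfold P. replace (apothem + u) with (apothem + 1 / 2 + (1 - a))
        by (unfold a; field).
      rewrite no_detour_1_swap, no_detour_2_side by (assumption || unfold a; lra).
      rewrite bary_swap. f_equal; ring. }
    assert (Ha : 0 <= a <= 1) by (unfold a; lra).
    replace u with (3 / 2 - a) in bound |- * by (unfold a; ring).
    destruct (Rle_dec a r) as [Har|Har].
    + apply (bound (apothem + 1 / 2 + (1 - a)) a); try lra.
      rewrite EP, no_detour_2_side, pdist_bary by (assumption || lra). ring.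
    + assert (Hbd := side_interception_bound r a Hr ltac:(lra)).
      (* After a chase of duration v the law of cosines at the apex gives a^2 - a v + v^2 = (r +
         v)^2, again linear in v. *)
      set (v := (a ^ 2 - r ^ 2) / (a + 2 * r)) in *.
      assert (Ev : v * (a + 2 * r) = a ^ 2 - r ^ 2) by (unfold v; field; lra).
      assert (Hv : 0 <= v <= a) by nra.
      apply (bound (apothem + 1 / 2 + (1 - a + v)) (r + v)); try lra.
      rewrite EP, no_detour_2_side, pdist_bary by (assumption || lra). nra.
Qed.

(** * Which agent finds the exit, and the bound for all exits *)

Lemma evacuation_time_left (A B C : point) (r u : R) :
  unit_triangle A B C -> 0 <= u <= 3 / 2 ->
  evacuation_time (no_detour_1 A B C) (no_detour_2 A B C) r
    (no_detour_1 A B C (apothem + u)) =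
  evacuation_time_from (no_detour_1 A B C) (no_detour_2 A B C) r
    (no_detour_1 A B C (apothem + u)) (apothem + u).
Proof.
  intros HT Hu. assert (HT' := unit_triangle_swap _ _ _ HT).
  unfold evacuation_time.
  replace (discovery_time (no_detour_1 A B C) _) with (Finite (apothem + u))
    by (symmetry; rewrite no_detour_1_swap; apply no_detour_2_discovery; assumption).
  destruct (Rbar_le_dec _ _) as [_|H]; [reflexivity|]. destruct H.
  apply (proj2 (Glb_Rbar_correct _)). intros t [Ht E].
  apply no_detour_meet in E; [|assumption|lra..]. apply (proj1 E).
Qed.

(** The endpoints are excluded because both agents visit them; strictly between, the first agent
    never sees the exit and its discovery time is infinite. *)
Lemma evacuation_time_right (A B C : point) (r u : R) :
  unit_triangle A B C -> 0 < u < 3 / 2 ->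
  evacuation_time (no_detour_1 A B C) (no_detour_2 A B C) r
    (no_detour_2 A B C (apothem + u)) =
  evacuation_time_from (no_detour_2 A B C) (no_detour_1 A B C) r
    (no_detour_2 A B C (apothem + u)) (apothem + u).
Proof.
  intros HT Hu. assert (HT' := unit_triangle_swap _ _ _ HT).
  unfold evacuation_time.
  rewrite no_detour_2_discovery by (assumption || lra).
  replace (discovery_time (no_detour_1 A B C) _) with p_infty.
  - destruct (Rbar_le_dec _ _) as [H|_]; [destruct H|reflexivity].
  - symmetry. apply Glb_Rbar_empty. intros t [Ht E].
    (* Reads [E] in the reflected triangle, where the agents exchange roles. *)
    rewrite no_detour_1_swap, <- (no_detour_1_swap A C B) in E.
    apply no_detour_meet in E; [|assumption|lra..].
    destruct E as [_ [E|E]]; lra.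
Qed.

Lemma evacuation_time_no_detour_le (A B C P : point) (r : R) :
  unit_triangle A B C -> 0 < r < 1 -> on_perimeter A B C P ->
  Rbar_le (evacuation_time (no_detour_1 A B C) (no_detour_2 A B C) r P)
          (no_detour_worst r).
Proof.
  intros HT Hr HP. assert (HT' := unit_triangle_swap _ _ _ HT).
  assert (left : forall u, 0 <= u <= 3 / 2 ->
    Rbar_le (evacuation_time (no_detour_1 A B C) (no_detour_2 A B C) r
      (no_detour_1 A B C (apothem + u))) (no_detour_worst r)).
  { intros u Hu. rewrite evacuation_time_left by assumption.
    apply evacuation_time_from_no_detour_le; assumption. }
  destruct (on_perimeter_no_detour A B C P HT HP) as (u & Hu & [-> | ->]).
  - apply left, Hu.
  - destruct (Req_dec u 0) as [E0|E0];
      [rewrite <- no_detour_meet_eq by tauto; apply left, Hu|].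
    destruct (Req_dec u (3 / 2)) as [E1|E1];
      [rewrite <- no_detour_meet_eq by tauto; apply left, Hu|].
    rewrite evacuation_time_right by (assumption || lra).
    rewrite (no_detour_1_swap A B C), <- (no_detour_1_swap A C B).
    apply evacuation_time_from_no_detour_le; assumption.
Qed.

(** * The bound is attained at a base vertex *)

Lemma evacuation_time_no_detour_vertex (A B C : point) (r : R) :
  unit_triangle A B C -> 0 < r < 1 ->
  evacuation_time (no_detour_1 A B C) (no_detour_2 A B C) r B =
  Finite (no_detour_worst r).
Proof.
  intros HT Hr. assert (HT' := unit_triangle_swap _ _ _ HT).
  assert (Hy := apothem_gt0).
  assert (EB := proj1 (proj2 (vertex_bary A B C))).
  assert (EP : no_detour_1 A B C (apothem + 1 / 2) = B).
  { rewrite no_detour_1_swap, no_detour_2_base, bary_swap by (assumption || lra).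
    rewrite EB at 2. f_equal; field. }
  (* The only root of x^2 - x + 1 = (r + x)^2, where x is the time since the agents reached the base
     vertices. *)
  set (s := (1 - r ^ 2) / (2 * r + 1)).
  assert (Es : s * (2 * r + 1) = 1 - r ^ 2) by (unfold s; field; lra).
  assert (Hs : 0 <= s <= 1) by nra.
  assert (dist_side : forall x, 0 <= x <= 1 ->
    pdist B (no_detour_2 A B C (apothem + 1 / 2 + x)) ^ 2 = x ^ 2 - x + 1).
  { intros x Hx. rewrite no_detour_2_side by assumption.
    rewrite EB at 1. rewrite pdist_bary by (assumption || lra). ring. }
  assert (Ed : pdist B (no_detour_2 A B C (apothem + 1 / 2 + s)) = r + s).
  { apply pdist_eq; [lra|]. rewrite dist_side by assumption. nra. }
  assert (EL := evacuation_time_left A B C r (1 / 2) HT ltac:(lra)).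
  rewrite EP in EL. rewrite EL.
  rewrite (evacuation_time_from_eq _ _ _ _ _ (apothem + 1 / 2 + s)).
  - rewrite Ed. unfold no_detour_worst. f_equal.
    unfold s. field. lra.
  - lra.
  - exact EP.
  - intros t Ht E. apply (eq_trans (z := no_detour_1 A B C (apothem + 1 / 2))) in E;
      [|symmetry; exact EP].
    apply no_detour_meet in E; [|assumption|lra..].
    destruct E as [_ [E|E]]; lra.
  - lra.
  - rewrite Ed. lra.
  - intros t Ht Hev.
    (* For x < s the squared distance x^2 - x + 1 exceeds (r + x)^2, so no earlier interception is
       possible. *)
    destruct (Rle_dec (apothem + 1 / 2 + s) t) as [H|H]; [exact H|].
    replace t with (apothem + 1 / 2 + (t - apothem - 1 / 2)) in Hev by ring.
    assert (Hx := dist_side (t - apothem - 1 / 2) ltac:(lra)).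
    assert (H0 := pdist_ge0 B
      (no_detour_2 A B C (apothem + 1 / 2 + (t - apothem - 1 / 2)))).
    nra.
Qed.

Theorem theorem3p1 (A B C : point) (r y : R)
  (hAB : pdist A B = 1) (hBC : pdist B C = 1) (hCA : pdist C A = 1)
  (hr : 0 < r < 1) (hy : y = sqrt 3 / 6) :
  E_no_detour A B C r =
    Finite (y + 1 / 2 + r + 2 * (1 - r ^ 2) / (2 * r + 1)).
Proof.
  assert (HT : unit_triangle A B C) by (repeat split; assumption).
  subst y. fold apothem. fold (no_detour_worst r).
  apply Rbar_is_lub_unique.
  split.
  - intros T (P & HP & ->). apply evacuation_time_no_detour_le; assumption.
  - intros b Hb. apply Hb. exists B. split.
    + left. exists 1. split; [lra|]. symmetry. apply lerp_1.
    + symmetry. apply evacuation_time_no_detour_vertex; assumption.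
Qed.
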